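(* Let $Z = (z_{ij}) \in \mathbb{Q}^{2\times 2}$ be a skew-symmetric quaternion matrix with $Z \neq O$, and let $a = z_{12}$. Then $a \neq 0$, and $W = -Z\bar Z$ has a double positive right eigenvalue $|a|^2$.
   Context: $\mathbb{Q}$ denotes the (noncommutative) real quaternions $q = q_0 + q_1\mathbf{i} + q_2\mathbf{j} + q_3\mathbf{k}$, with $q_0,\dots,q_3 \in \mathbb{R}$; $\bar q = q_0 - q_1\mathbf{i} - q_2\mathbf{j} - q_3\mathbf{k}$ is the quaternion conjugate and $|q| = \sqrt{q_0^2+q_1^2+q_2^2+q_3^2}$. For a quaternion matrix $A = (a_{ij})$, $A^\top = (a_{ji})$ is the transpose, $\bar A = (\bar a_{ij})$ is the entrywise conjugate, and $A^* = (\bar a_{ji}) = \bar A^\top$ is the conjugate transpose. A square matrix $Z$ is skew-symmetric if $Z^\top = -Z$, and $A$ is Hermitian if $A^* = A$. $O$ is the zero matrix. A quaternion $\lambda$ is a right eigenvalue of $A \in \mathbb{Q}^{n\times n}$ if $A\mathbf{x} = \mathbf{x}\lambda$ for some nonzero $\mathbf{x} \in \mathbb{Q}^n$. A Hermitian $A \in \mathbb{Q}^{n\times n}$ has exactly $n$ real right eigenvalues counted with multiplicity, namely $\lambda_1 \ge \cdots \ge \lambda_n$ such that $U^*AU = \mathrm{diag}(\lambda_1,\dots,\lambda_n)$ for some unitary $U \in \mathbb{Q}^{n\times n}$ (i.e. $U^*U = I$). ''Double'' means multiplicity two in this sense. *)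

(* Defs.v *)
From HB Require Import structures.
From mathcomp Require Import all_boot all_order all_algebra.
From mathcomp Require Import ring.
From mathcomp Require Import reals.

Set Implicit Arguments.
Unset Strict Implicit.
Unset Printing Implicit Defensive.

Import Order.TTheory GRing.Theory Num.Theory.
Local Open Scope ring_scope.

(* [Quat a b c d] is a + b i + c j + d k. *)
Record quat (R : rcfType) := Quat { q_re : R; q_i : R; q_j : R; q_k : R }.

Definition quat_tuple (R : rcfType) (q : quat R) : R * R * R * R :=
  (q_re q, q_i q, q_j q, q_k q).
Definition tuple_quat (R : rcfType) (t : R * R * R * R) : quat R :=
  Quat t.1.1.1 t.1.1.2 t.1.2 t.2.

Lemma quat_tupleK (R : rcfType) : cancel (@quat_tuple R) (@tuple_quat R).
Proof. by case. Qed.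

HB.instance Definition _ (R : rcfType) :=
  Equality.copy (quat R) (can_type (@quat_tupleK R)).
HB.instance Definition _ (R : rcfType) :=
  Choice.copy (quat R) (can_type (@quat_tupleK R)).

Definition quat0 (R : rcfType) : quat R := Quat 0 0 0 0.
Definition quat1 (R : rcfType) : quat R := Quat 1 0 0 0.
Definition quat_opp (R : rcfType) (x : quat R) : quat R :=
  Quat (- q_re x) (- q_i x) (- q_j x) (- q_k x).
Definition quat_add (R : rcfType) (x y : quat R) : quat R :=
  Quat (q_re x + q_re y) (q_i x + q_i y) (q_j x + q_j y) (q_k x + q_k y).

(* Hamilton's product: i^2 = j^2 = k^2 = i j k = -1. *)
Definition quat_mul (R : rcfType) (x y : quat R) : quat R :=
  let: Quat a b c d := x in
  let: Quat a' b' c' d' := y in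
  Quat (a * a' - b * b' - c * c' - d * d')
       (a * b' + b * a' + c * d' - d * c')
       (a * c' - b * d' + c * a' + d * b')
       (a * d' + b * c' - c * b' + d * a').

Lemma quat_addA (R : rcfType) : associative (@quat_add R).
Proof. by move=> [????] [????] [????]; congr Quat; apply: addrA. Qed.
Lemma quat_addC (R : rcfType) : commutative (@quat_add R).
Proof. by move=> [????] [????]; congr Quat; apply: addrC. Qed.
Lemma quat_add0 (R : rcfType) : left_id (quat0 R) (@quat_add R).
Proof. by move=> [????]; congr Quat; apply: add0r. Qed.
Lemma quat_addN (R : rcfType) :
  left_inverse (quat0 R) (@quat_opp R) (@quat_add R).
Proof. by move=> [????]; congr Quat; apply: addNr. Qed.

HB.instance Definition _ (R : rcfType) :=
  GRing.isZmodule.Build (quat R)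
    (@quat_addA R) (@quat_addC R) (@quat_add0 R) (@quat_addN R).

Lemma quat_mulA (R : rcfType) : associative (@quat_mul R).
Proof. by move=> [????] [????] [????]; congr Quat; ring. Qed.
Lemma quat_mul1q (R : rcfType) : left_id (quat1 R) (@quat_mul R).
Proof. by move=> [????]; congr Quat; ring. Qed.
Lemma quat_mulq1 (R : rcfType) : right_id (quat1 R) (@quat_mul R).
Proof. by move=> [????]; congr Quat; ring. Qed.
Lemma quat_mulDl (R : rcfType) :
  left_distributive (@quat_mul R) (@quat_add R).
Proof. by move=> [????] [????] [????]; congr Quat => /=; ring. Qed.
Lemma quat_mulDr (R : rcfType) :
  right_distributive (@quat_mul R) (@quat_add R).
Proof. by move=> [????] [????] [????]; congr Quat => /=; ring. Qed.
Lemma quat_1_neq0 (R : rcfType) : quat1 R != 0.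
Proof. by apply/eqP => -[] /eqP; rewrite oner_eq0. Qed.

HB.instance Definition _ (R : rcfType) :=
  GRing.Zmodule_isNzRing.Build (quat R)
    (@quat_mulA R) (@quat_mul1q R) (@quat_mulq1 R)
    (@quat_mulDl R) (@quat_mulDr R) (@quat_1_neq0 R).

Definition quat_real (R : rcfType) (r : R) : quat R := Quat r 0 0 0.

Definition quat_conj (R : rcfType) (q : quat R) : quat R :=
  Quat (q_re q) (- q_i q) (- q_j q) (- q_k q).

Definition quat_abs (R : rcfType) (q : quat R) : R :=
  Num.sqrt (q_re q ^+ 2 + q_i q ^+ 2 + q_j q ^+ 2 + q_k q ^+ 2).

Definition mx_conj (R : rcfType) (m n : nat) (A : 'M[quat R]_(m, n)) :
  'M[quat R]_(m, n) := map_mx (@quat_conj R) A.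

Definition mx_adj (R : rcfType) (m n : nat) (A : 'M[quat R]_(m, n)) :
  'M[quat R]_(n, m) := (mx_conj A)^T.

Definition skew_symmetric (R : rcfType) (n : nat) (Z : 'M[quat R]_n) : Prop :=
  Z^T = - Z.

Definition hermitian_mx (R : rcfType) (n : nat) (A : 'M[quat R]_n) : Prop :=
  mx_adj A = A.

Definition unitary_mx (R : rcfType) (n : nat) (U : 'M[quat R]_n) : Prop :=
  mx_adj U *m U = 1%:M.

(* Quaternions do not commute: the eigenvalue multiplies on the right, so the
   left scaling [*:] of the library cannot be used here. *)
Definition right_eigenvalue (R : rcfType) (n : nat) (A : 'M[quat R]_n)
    (lam : quat R) : Prop :=
  exists x : 'cV[quat R]_n, x != 0 /\ A *m x = \col_i (x i 0 * lam).

Definition real_eigenvalue_list (R : rcfType) (n : nat) (A : 'M[quat R]_n)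
    (d : 'rV[R]_n) : Prop :=
  (forall i j : 'I_n, (i <= j)%N -> d 0 j <= d 0 i) /\
  exists U : 'M[quat R]_n,
    unitary_mx U /\ mx_adj U *m A *m U = diag_mx (map_mx (@quat_real R) d).

(* [lam] is an eigenvalue of multiplicity [m] of the Hermitian matrix [A].  The
   list of real eigenvalues of [A] is unique, but the definition does not rely
   on it: a list exists, and [lam] occurs [m] times in every such list. *)
Definition real_eigenvalue_mult (R : rcfType) (n : nat) (A : 'M[quat R]_n)
    (lam : R) (m : nat) : Prop :=
  [/\ hermitian_mx A,
      exists d : 'rV[R]_n, real_eigenvalue_list A d &
      forall d : 'rV[R]_n, real_eigenvalue_list A d ->
        #|[set i : 'I_n | d 0 i == lam]| = m].

(* Main.v *)
(* A skew-symmetric 2 x 2 matrix Z has rows (0, a) and (-a, 0), so that the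
   product of -Z with its conjugate is a * conj a * I = |a|^2 I.  As a real
   scalar is central, every unitary conjugate of this matrix is again |a|^2 I,
   hence |a|^2 is the only entry of every list of its eigenvalues. *)
Require Import Defs.
From HB Require Import structures.
From mathcomp Require Import all_boot all_order all_algebra.
From mathcomp Require Import ring.
From mathcomp Require Import reals.

Set Implicit Arguments.
Unset Strict Implicit.
Unset Printing Implicit Defensive.

Import Order.TTheory GRing.Theory Num.Theory.
Local Open Scope ring_scope.

Lemma quat_real_comm (R : rcfType) (r : R) (q : quat R) :
  quat_real r * q = q * quat_real r.
Proof. by case: q => a b c d; congr Quat; ring. Qed.

Lemma quat_conj_real (R : rcfType) (r : R) :
  quat_conj (quat_real r) = quat_real r.
Proof. by rewrite /quat_conj /= oppr0. Qed.

Lemma quat_conj0 (R : rcfType) : quat_conj (0 : quat R) = 0.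
Proof. exact: quat_conj_real. Qed.

Lemma quat_conjN (R : rcfType) (q : quat R) : quat_conj (- q) = - quat_conj q.
Proof. by []. Qed.

Lemma sqr_quat_abs (R : rcfType) (q : quat R) :
  quat_abs q ^+ 2 = q_re q ^+ 2 + q_i q ^+ 2 + q_j q ^+ 2 + q_k q ^+ 2.
Proof. by rewrite sqr_sqrtr // !addr_ge0 ?sqr_ge0. Qed.

Lemma quat_mul_conj (R : rcfType) (q : quat R) :
  q * quat_conj q = quat_real (quat_abs q ^+ 2).
Proof. by rewrite sqr_quat_abs; case: q => a b c d; congr Quat => /=; ring. Qed.

(** A sum of four squares in an ordered field vanishes only if every term does. *)
Lemma sqr_quat_abs_gt0 (R : rcfType) (q : quat R) :
  (0 < quat_abs q ^+ 2) = (q != 0).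
Proof.
rewrite lt0r sqr_ge0 andbT; congr (~~ _); apply/idP/eqP => [|->]; last first.
  by rewrite sqr_quat_abs /= expr0n /= !addr0.
rewrite sqr_quat_abs !paddr_eq0 ?addr_ge0 ?sqr_ge0 // !sqrf_eq0.
by case: q => a b c d /= /andP[/andP[/andP[/eqP-> /eqP->] /eqP->] /eqP->].
Qed.

(** Holds componentwise, since 2 is invertible in [R]; it kills the diagonal of a skew-symmetric
    matrix. *)
Lemma quat_eqN (R : rcfType) (q : quat R) : q = - q -> q = 0.
Proof.
case: q => a b c d [/esym/eqP + /esym/eqP + /esym/eqP + /esym/eqP].
by rewrite !eqNr => /eqP-> /eqP-> /eqP-> /eqP->.
Qed.

Section RealScalarMatrix.
Variables (R : rcfType) (n : nat) (r : R).
Implicit Type U : 'M[quat R]_n.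

Lemma mx_adj_real_scalar :
  mx_adj (quat_real r)%:M = (quat_real r)%:M :> 'M[quat R]_n.
Proof.
apply/matrixP => i j; rewrite !mxE eq_sym.
by case: eqP => _; rewrite ?mulr1n ?mulr0n ?quat_conj_real ?quat_conj0.
Qed.

Lemma unitary_conj_real_scalar U :
  unitary_mx U -> mx_adj U *m (quat_real r)%:M *m U = (quat_real r)%:M.
Proof.
move=> U_unitary; have -> : mx_adj U *m (quat_real r)%:M
    = (quat_real r)%:M *m mx_adj U.
  (* Seen as a diagonal matrix, the scalar acts by scaling rows on one side and columns on the
     other, so commutation reduces to single entries. *)
  rewrite -!diag_const_mx mul_diag_mx mul_mx_diag.
  by apply/matrixP => i j; rewrite !mxE quat_real_comm.
by rewrite -mulmxA U_unitary mulmx1.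
Qed.

Lemma unitary_mx1 : unitary_mx (1%:M : 'M[quat R]_n).
Proof.
rewrite /unitary_mx mulmx1; apply/matrixP => i j; rewrite !mxE eq_sym.
by case: eqP => _; rewrite ?mulr1n ?mulr0n ?quat_conj0 // quat_conj_real.
Qed.

Lemma real_eigenvalue_list_real_scalar (d : 'rV[R]_n) :
  real_eigenvalue_list (quat_real r)%:M d <-> d = const_mx r.
Proof.
split=> [[_ [U [U_unitary]]]|->].
  (* Whatever [U] is, it cancels, and the diagonal entries then give [d]. *)
  rewrite unitary_conj_real_scalar // => /matrixP diag_d.
  apply/rowP => i; have := diag_d i i.
  by rewrite !mxE eqxx !mulr1n => -[].
split=> [i j _|]; first by rewrite !mxE.
exists 1%:M; split; first exact: unitary_mx1.
by rewrite (unitary_conj_real_scalar unitary_mx1) map_const_mx diag_const_mx.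
Qed.

Lemma real_eigenvalue_mult_real_scalar :
  real_eigenvalue_mult ((quat_real r)%:M : 'M[quat R]_n) r n.
Proof.
split; first exact: mx_adj_real_scalar.
  by exists (const_mx r); apply/real_eigenvalue_list_real_scalar.
move=> d /real_eigenvalue_list_real_scalar ->.
rewrite -[RHS]card_ord -cardsT; congr #|pred_of_set _|.
by apply/setP => i; rewrite !inE mxE eqxx.
Qed.

End RealScalarMatrix.

Lemma right_eigenvalue_real_scalar (R : rcfType) (n : nat) (r : R) :
  right_eigenvalue ((quat_real r)%:M : 'M[quat R]_n.+1) (quat_real r).
Proof.
(* Any nonzero column would do; the size [n.+1] provides the entry 0 that witnesses nonzeroness. *)
exists (const_mx 1); split.
  by apply/eqP => /matrixP/(_ 0 0); rewrite !mxE; apply/eqP; apply: oner_neq0.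
by rewrite mul_scalar_mx; apply/matrixP => i j; rewrite !mxE quat_real_comm.
Qed.

Lemma ord2_eq (i : 'I_2) : i = 0 \/ i = 1.
Proof. by case: i => -[|[|//]] ?; [left|right]; apply: val_inj. Qed.

Lemma skew_symmetric_diag (R : rcfType) (n : nat) (Z : 'M[quat R]_n) i :
  skew_symmetric Z -> Z i i = 0.
Proof. by move=> /matrixP/(_ i i); rewrite !mxE => /quat_eqN. Qed.

(** The booleans count as 0 or 1, so one formula covers all four entries and shows that [Z 0 1]
    determines [Z]. *)
Lemma skew_symmetric2E (R : rcfType) (Z : 'M[quat R]_2) (i j : 'I_2) :
  skew_symmetric Z -> Z i j = Z 0 1 *+ (i < j) - Z 0 1 *+ (j < i).
Proof.
move=> Z_skew; have Z10 : Z 1 0 = - Z 0 1.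
  by move/matrixP: Z_skew => /(_ 0 1); rewrite !mxE.
have [->|->] := ord2_eq i; have [->|->] := ord2_eq j => /=;
  by rewrite ?mulr1n ?mulr0n ?subr0 ?sub0r ?Z10 ?oppr0 ?skew_symmetric_diag.
Qed.

Lemma skew_symmetric2_mul_conj (R : rcfType) (Z : 'M[quat R]_2) :
  skew_symmetric Z ->
  - (Z *m mx_conj Z) = (quat_real (quat_abs (Z 0 1) ^+ 2))%:M.
Proof.
move=> Z_skew; apply/matrixP => i j.
(* With [a = Z 0 1], both diagonal entries become [a * quat_conj a] in this very order; off the
   diagonal, each summand contains a diagonal entry of [Z] or of its conjugate, which is zero. *)
rewrite -quat_mul_conj !mxE big_ord_recl big_ord1 !mxE.
rewrite ![Z i _]skew_symmetric2E // ![Z _ j]skew_symmetric2E //.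
have [->|->] := ord2_eq i; have [->|->] := ord2_eq j => /=;
  by rewrite ?(mulr1n, mulr0n, subr0, sub0r, oppr0, quat_conj0, quat_conjN,
               mul0r, mulr0, mulrN, mulNr, add0r, addr0, opprK).
Qed.

Theorem proposition4p1 (R : realType) (Z : 'M[quat R]_2)
    (Z_skew : skew_symmetric Z) (Z_neq0 : Z != 0) :
  let a : quat R := Z 0 1 in
  let W : 'M[quat R]_2 := - (Z *m mx_conj Z) in
  a != 0 /\
  [/\ 0 < quat_abs a ^+ 2,
      right_eigenvalue W (quat_real (quat_abs a ^+ 2)) &
      real_eigenvalue_mult W (quat_abs a ^+ 2) 2].
Proof.
move=> a W.
have a_neq0 : a != 0.
  apply: contra_neq Z_neq0 => a0; apply/matrixP => i j.
  by rewrite skew_symmetric2E // -/a a0 !mul0rn subr0 mxE.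
(* Positivity of the eigenvalue turns into [a != 0]; the rest concerns a real scalar matrix. *)
rewrite /W skew_symmetric2_mul_conj // sqr_quat_abs_gt0; split=> //; split=> //.
  exact: right_eigenvalue_real_scalar.
exact: real_eigenvalue_mult_real_scalar.
Qed.
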